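(* If $w_i=1/d_i$ for all $i\in N$, then, with the items numbered so that $d_1\ge\cdots\ge d_n$, the problems W-Dis-Vol$(p)$ and W-Dis-Vol$(p,k)$ can be solved in $O(np^2)$ and $O(nk^2p)$ time, respectively.
   Context: Let $N=\{1,\ldots,n\}$ be a set of items. An instance consists of non-negative rational vectors $C=(C_1,\ldots,C_n)$ (fixed costs), $\underline c=(\underline c_1,\ldots,\underline c_n)$ (nominal uncertain costs), a positive rational vector $d=(d_1,\ldots,d_n)$ (maximal deviations), weights $w_1,\ldots,w_n$, a positive rational number $\Gamma$ (uncertainty budget), and positive integers $p$ and (where applicable) $k$ with $k\le p\le n$. Decisions are binary vectors $x,y\in\{0,1\}^n$; products such as $Cx$ denote scalar products. Define $$F(p)=\Big\{(x,y): \sum_{i\in N}(x_i+y_i)=p,\ \sum_{i\in N}x_iy_i=0\Big\},$$ $$F(p,k)=\Big\{(x,y): \sum_{i\in N}x_i=p,\ \sum_{i\in N}y_i=p,\ \sum_{i\in N}x_iy_i\ge p-k\Big\}.$$ W-Dis-Vol$(p)$ and W-Dis-Vol$(p,k)$ (discrete uncertainty with weighted volume budget) are the problem $$\min_{(x,y)\in F}\Big\{Cx+\max_{\delta_i\in\{0,d_i\},\,i\in N}\big\{(\underline c+\delta)y: \sum_{i\in N}w_i\delta_i\le\Gamma\big\}\Big\}$$ with $F=F(p)$ and $F=F(p,k)$, respectively. Solving a problem means computing the optimal value and an optimal $(x,y)$. Running time counts elementary arithmetic operations and comparisons on numbers. *)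

(* Defs.v *)
From HB Require Import structures.
From mathcomp Require Import all_boot all_order all_algebra.

Set Implicit Arguments.
Unset Strict Implicit.
Unset Printing Implicit Defensive.

Import Order.TTheory GRing.Theory Num.Theory.
Local Open Scope ring_scope.

(** * The optimization problems *)

(* Items are numbered from 0: item i of the usual numbering is (i - 1) : 'I_n. *)
Record instance (n : nat) := Instance {
  fixed_cost    : n.-tuple rat;
  nominal_cost  : n.-tuple rat;
  max_deviation : n.-tuple rat;
  weight        : n.-tuple rat;
  budget        : rat
}.

Definition valid_instance n (I : instance n) : Prop :=
  [/\ forall i, 0 <= tnth (fixed_cost I) i,
      forall i, 0 <= tnth (nominal_cost I) i,
      forall i, 0 < tnth (max_deviation I) i
    & 0 < budget I].

(* The scenario delta in prod_i {0, d_i} selected by the bit vector z. *)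
Definition scenario n (I : instance n) (z : n.-tuple bool) (i : 'I_n) : rat :=
  if tnth z i then tnth (max_deviation I) i else 0.

Definition admissible n (I : instance n) : pred (n.-tuple bool) :=
  fun z => \sum_(i < n) tnth (weight I) i * scenario I z i <= budget I.

Definition scenario_cost n (I : instance n) (y z : n.-tuple bool) : rat :=
  \sum_(i < n) (tnth (nominal_cost I) i + scenario I z i) * (tnth y i)%:R.

(* The zero scenario is admissible when the budget is positive, so using its
   cost as the default element of the iterated maximum does not change the
   maximum; see worst_caseP. *)
Definition worst_case n (I : instance n) (y : n.-tuple bool) : rat :=
  \big[Num.max/scenario_cost I y [tuple of nseq n false]]_(z | admissible I z)
    scenario_cost I y z.

Lemma worst_caseP n (I : instance n) (y : n.-tuple bool) :
  0 < budget I ->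
  (exists2 z, admissible I z & worst_case I y = scenario_cost I y z) /\
  (forall z, admissible I z -> scenario_cost I y z <= worst_case I y).
Proof.
move=> Gpos; set z0 : n.-tuple bool := [tuple of nseq n false].
have adm0 : admissible I z0.
  rewrite /admissible big1 ?ltW // => i _.
  by rewrite /scenario (tnth_nth false) nth_nseq if_same mulr0.
split; last by move=> z Hz; exact: le_bigmax_cond.
rewrite /worst_case.
pose K v := exists2 z, admissible I z & v = scenario_cost I y z.
apply: (big_ind K) => [|v v' Hv Hv'|z Hz]; first by exists z0.
- by rewrite /Order.max; case: ifP.
- by exists z.
Qed.

Definition objective n (I : instance n) (x y : n.-tuple bool) : rat :=
  \sum_(i < n) tnth (fixed_cost I) i * (tnth x i)%:R + worst_case I y.

Definition feasible_p n (p : nat) (x y : n.-tuple bool) : Prop :=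
  ((\sum_(i < n) (tnth x i + tnth y i))%N = p) /\
  ((\sum_(i < n) tnth x i * tnth y i)%N = 0%N).

(* The truncated subtraction is harmless: it is used only for k <= p. *)
Definition feasible_pk n (p k : nat) (x y : n.-tuple bool) : Prop :=
  [/\ (\sum_(i < n) tnth x i)%N = p,
      (\sum_(i < n) tnth y i)%N = p
    & (p - k <= \sum_(i < n) tnth x i * tnth y i)%N].

Definition optimal n (I : instance n) (F : n.-tuple bool -> n.-tuple bool -> Prop)
    (x y : n.-tuple bool) (v : rat) : Prop :=
  [/\ F x y, objective I x y = v
    & forall x' y', F x' y' -> v <= objective I x' y'].

(** * The model of computation

   A unit-cost random-access machine programmed in a structured language.  It
   has finitely many (those named in the program) unbounded arrays of two
   sorts: integer arrays, whose entries serve as counters and indices, and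
   number arrays, whose entries are rationals.  A scalar is entry 0 of an array.
   Rationals can be compared but not converted into integers, so no rounding
   operation is available.  Every arithmetic operation, comparison, Boolean
   connective, constant, array access, assignment and branching costs 1. *)

Record state := State {
  ints : nat -> nat -> nat;
  nums : nat -> nat -> rat
}.

Inductive iexpr :=
  | IConst of nat
  | IGet of nat & iexpr
  | IAdd of iexpr & iexpr
  | ISub of iexpr & iexpr
  | IMul of iexpr & iexpr.

Inductive qexpr :=
  | QConst of rat
  | QGet of nat & iexpr
  | QAdd of qexpr & qexpr
  | QSub of qexpr & qexpr
  | QMul of qexpr & qexpr
  | QDiv of qexpr & qexpr.

Inductive bexpr :=
  | BLeI of iexpr & iexpr
  | BLeQ of qexpr & qexpr
  | BNot of bexpr
  | BAnd of bexpr & bexpr.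

Inductive com :=
  | Skip
  | ISet of nat & iexpr & iexpr
  | QSet of nat & iexpr & qexpr
  | Seq of com & com
  | If of bexpr & com & com
  | While of bexpr & com.

Fixpoint ieval (s : state) (e : iexpr) : nat :=
  match e with
  | IConst m => m
  | IGet a e1 => ints s a (ieval s e1)
  | IAdd e1 e2 => (ieval s e1 + ieval s e2)%N
  | ISub e1 e2 => (ieval s e1 - ieval s e2)%N
  | IMul e1 e2 => (ieval s e1 * ieval s e2)%N
  end.

Fixpoint qeval (s : state) (e : qexpr) : rat :=
  match e with
  | QConst q => q
  | QGet a e1 => nums s a (ieval s e1)
  | QAdd e1 e2 => qeval s e1 + qeval s e2
  | QSub e1 e2 => qeval s e1 - qeval s e2
  | QMul e1 e2 => qeval s e1 * qeval s e2
  | QDiv e1 e2 => qeval s e1 / qeval s e2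
  end.

Fixpoint beval (s : state) (b : bexpr) : bool :=
  match b with
  | BLeI e1 e2 => (ieval s e1 <= ieval s e2)%N
  | BLeQ e1 e2 => qeval s e1 <= qeval s e2
  | BNot b1 => ~~ beval s b1
  | BAnd b1 b2 => beval s b1 && beval s b2
  end.

Fixpoint icost (e : iexpr) : nat :=
  match e with
  | IConst _ => 1
  | IGet _ e1 => (icost e1).+1
  | IAdd e1 e2 | ISub e1 e2 | IMul e1 e2 => (icost e1 + icost e2).+1
  end.

Fixpoint qcost (e : qexpr) : nat :=
  match e with
  | QConst _ => 1
  | QGet _ e1 => (icost e1).+1
  | QAdd e1 e2 | QSub e1 e2 | QMul e1 e2 | QDiv e1 e2 =>
      (qcost e1 + qcost e2).+1
  end.

Fixpoint bcost (b : bexpr) : nat :=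
  match b with
  | BLeI e1 e2 => (icost e1 + icost e2).+1
  | BLeQ e1 e2 => (qcost e1 + qcost e2).+1
  | BNot b1 => (bcost b1).+1
  | BAnd b1 b2 => (bcost b1 + bcost b2).+1
  end.

Definition update T (m : nat -> nat -> T) (a j : nat) (v : T) :
    nat -> nat -> T :=
  fun a' j' => if (a' == a) && (j' == j) then v else m a' j'.

(* exec c s s' t: started in s, the program c halts in s' after time t. *)
Inductive exec : com -> state -> state -> nat -> Prop :=
  | ExecSkip s : exec Skip s s 1
  | ExecISet a i e s :
      exec (ISet a i e) s
        (State (update (ints s) a (ieval s i) (ieval s e)) (nums s))
        (icost i + icost e).+1
  | ExecQSet a i e s :
      exec (QSet a i e) s
        (State (ints s) (update (nums s) a (ieval s i) (qeval s e)))
        (icost i + qcost e).+1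
  | ExecSeq c1 c2 s1 s2 s3 t1 t2 :
      exec c1 s1 s2 t1 -> exec c2 s2 s3 t2 ->
      exec (Seq c1 c2) s1 s3 (t1 + t2)
  | ExecIfTrue b c1 c2 s s' t :
      beval s b -> exec c1 s s' t ->
      exec (If b c1 c2) s s' (bcost b + t).+1
  | ExecIfFalse b c1 c2 s s' t :
      ~~ beval s b -> exec c2 s s' t ->
      exec (If b c1 c2) s s' (bcost b + t).+1
  | ExecWhileTrue b c s1 s2 s3 t1 t2 :
      beval s1 b -> exec c s1 s2 t1 -> exec (While b c) s2 s3 t2 ->
      exec (While b c) s1 s3 (bcost b + t1 + t2).+1
  | ExecWhileFalse b c s :
      ~~ beval s b -> exec (While b c) s s (bcost b).+1.

(* Integer array 0 holds the integer parameters; number arrays 0 to 4 hold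
   C, c, d, w and the one-entry array containing Gamma.  All other memory is 0. *)
Definition input_state n (I : instance n) (params : seq nat) : state :=
  State
    (fun a j => if a == 0%N then nth 0%N params j else 0%N)
    (fun a j => nth 0 (nth [::]
       [:: val (fixed_cost I); val (nominal_cost I); val (max_deviation I);
           val (weight I); [:: budget I]] a) j).

(* Integer arrays 1 and 2 hold the bits of x and y; entry 0 of number array 5
   holds the value. *)
Definition output_is n (s : state) (x y : n.-tuple bool) (v : rat) : Prop :=
  [/\ forall i : 'I_n, ints s 1 i = tnth x i,
      forall i : 'I_n, ints s 2 i = tnth y i
    & nums s 5 0 = v].

(* Started on the given instance and integer parameters, the program computes
   the optimal value and an optimal pair for the feasible set F within time T. *)
Definition solves_within (prog : com) n (I : instance n) (params : seq nat)
    (F : n.-tuple bool -> n.-tuple bool -> Prop) (T : nat) : Prop :=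
  exists s t, [/\ exec prog (input_state I params) s t, (t <= T)%N
    & exists x y v, output_is s x y v /\ optimal I F x y v].

(* Main.v *)
Require Import Defs.
From HB Require Import structures.
From mathcomp Require Import all_boot all_order all_algebra.
From mathcomp Require Import zify.

Set Implicit Arguments.
Unset Strict Implicit.
Unset Printing Implicit Defensive.

Import Order.TTheory GRing.Theory Num.Theory.
Local Open Scope ring_scope.

(** With w_i = 1/d_i the budget only limits the number of deviating items to
    the integer part g of Gamma.  As the deviations are non-increasing, a worst
    scenario for y lets exactly the first g items of y deviate, so the cost of
    item i depends only on the number of items of y up to i.  Hence both
    problems are solved by one dynamic program over the items, whose state
    consists of the sizes of X :&: Y, X :\: Y and Y :\: X among the first i items.
    For F(p) these are bounded by 0, p, p and the final states are (0, j, p - j);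
    for F(p, k) they are bounded by p, k, k and the final states are
    (p - j, j, j). *)

(** * Worst-case scenarios *)

(** The inner maximum is a function of all of y; replacing it by the greedy scenario makes the cost
    additive along the items, because whether an item deviates is then settled by what precedes it.
    This is what a forward recurrence needs. The machine has no rounding, so g itself is never
    computed: the program tabulates the rationals 0, ..., 2n and compares the required entry with
    Gamma. Optimality splits into two separate arguments: the Bellman inequalities bound the cost of
    every selection from below, and tracing back the stored decisions produces a selection that
    attains the bound. With A and B bounding the sizes, each of the n levels has (A + 1)(B + 1)^2
    cells of constant cost; p and k being positive, the added ones go into the constants 4 and 8. *)

Section Greedy.
Variables (d : nat -> rat) (g : nat) (y : nat -> bool).

Definition rank i : nat := (\sum_(j < i) y j)%N.

Definition greedy i : bool := y i && (rank i < g)%N.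

Lemma card_greedy n : (\sum_(i < n) greedy i)%N = minn (rank n) g.
Proof.
rewrite /rank; elim: n => [|n IHn]; first by rewrite !big_ord0 min0n.
rewrite !big_ord_recr /= IHn /greedy /rank.
by case: (y n); case: ltnP => /=; lia.
Qed.

(** The case needed is [t = 0]; a general lower bound [t] on the deviations is what the induction
    requires, since once the greedy budget is spent it is applied with [t = d n]. *)
Lemma greedy_max N n (u : nat -> bool) (t : rat) :
  (forall i j, (i <= j)%N -> (j < N)%N -> d j <= d i) -> (n <= N)%N ->
  (forall i, u i -> y i) -> (\sum_(i < n) u i <= g)%N ->
  (forall i, (i < n)%N -> t <= d i) ->
  \sum_(i < n) (d i - t) *+ u i <= \sum_(i < n) (d i - t) *+ greedy i.
Proof.
move=> d_noninc; elim: n t => [|n IHn] t n_le_N u_y card_u t_le_d.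
  by rewrite !big_ord0.
have t_le_dn : 0 <= d n - t by rewrite subr_ge0; exact: t_le_d.
have card_un : (\sum_(i < n) u i + u n <= g)%N by rewrite big_ord_recr in card_u.
have IHt : \sum_(i < n) (d i - t) *+ u i <= \sum_(i < n) (d i - t) *+ greedy i.
  by apply: IHn => // [||i lt_in]; [lia | lia | apply: t_le_d; lia].
rewrite !big_ord_recr /=.
case un: (u n) card_un => card_un; last first.
  by rewrite mulr0n addr0 (le_trans IHt) // lerDl mulrn_wge0.
have [|] := boolP (greedy n) => [_|]; first by rewrite lerD2r.
rewrite /greedy u_y //= -leqNgt => full; rewrite mulr0n addr0.
(* The deviation of item n is then the threshold that separates the greedy
   items from the others. *)
have IHd : \sum_(i < n) (d i - d n) *+ u i <= \sum_(i < n) (d i - d n) *+ greedy i.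
  by apply: IHn => // [||i lt_in]; [lia | lia | apply: d_noninc; lia].
have shift (v : nat -> bool) : \sum_(i < n) (d i - t) *+ v i =
    \sum_(i < n) (d i - d n) *+ v i + (d n - t) *+ (\sum_(i < n) v i)%N.
  rewrite -sumrMnr -big_split /=; apply: eq_bigr => i _.
  by rewrite -mulrnDl addrA subrK.
rewrite (shift u) (shift greedy) card_greedy (minn_idPr full) -addrA lerD // -mulrSr.
by apply: ler_wpMn2l => //; lia.
Qed.

End Greedy.

Section WorstCase.
Variables (n : nat) (I : instance n) (g : nat).
Hypothesis valid : valid_instance I.
Hypothesis weightE :
  forall i : 'I_n, tnth (weight I) i = 1 / tnth (max_deviation I) i.
Hypothesis dev_noninc : forall i j : 'I_n, (i <= j)%N ->
  tnth (max_deviation I) j <= tnth (max_deviation I) i.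
Hypothesis budget_floor : forall m : nat, (m%:R <= budget I) = (m <= g)%N.

Let d i := nth 0 (max_deviation I) i.

Lemma admissibleE (z : n.-tuple bool) :
  admissible I z = (\sum_(i < n) tnth z i <= g)%N.
Proof.
rewrite /admissible -budget_floor natr_sum; congr (_ <= _).
apply: eq_bigr => i _; rewrite /scenario weightE.
case: (tnth z i); rewrite ?mulr0 // mul1r mulVf // gt_eqF //.
by case: valid.
Qed.

Lemma scenario_costE (y z : n.-tuple bool) : scenario_cost I y z =
  \sum_(i < n) tnth (nominal_cost I) i *+ tnth y i +
  \sum_(i < n) tnth (max_deviation I) i *+ (tnth z i && tnth y i).
Proof.
rewrite -big_split /=; apply: eq_bigr => i _.
rewrite /scenario; case: (tnth y i); case: (tnth z i).
all: by rewrite /= ?mulr1 ?mulr0 ?mulr1n ?mulr0n ?addr0.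
Qed.

Lemma worst_case_greedy (y : n.-tuple bool) : worst_case I y =
  \sum_(i < n) tnth (nominal_cost I) i *+ tnth y i +
  \sum_(i < n) d i *+ greedy g (nth false y) i.
Proof.
have [_ _ d_gt0 budget_gt0] := valid.
have dE (i : 'I_n) : d i = tnth (max_deviation I) i by rewrite (tnth_nth 0).
have [[z adm_z ->] max_y] := worst_caseP y budget_gt0.
apply/eqP; rewrite eq_le; apply/andP; split.
- rewrite scenario_costE lerD2l.
  (* Deviations outside [y] cost nothing, so cutting [z] down to [y] keeps the cost and can only
     free budget. *)
  pose u i := nth false z i && nth false y i.
  have := @greedy_max d g (nth false y) n n u 0.
  have sub0 (v : nat -> bool) :
      \sum_(i < n) (d i - 0) *+ v i = \sum_(i < n) d i *+ v i.
    by apply: eq_bigr => i _; rewrite subr0.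
  rewrite (sub0 u) (sub0 (greedy _ _)) => le_greedy; apply: le_trans (le_greedy _ _ _ _ _) => //.
  + by apply: ler_sum => i _; rewrite /u -!tnth_nth dE.
  + move=> i j le_ij lt_jn; rewrite (dE (Ordinal lt_jn)).
    by rewrite (dE (Ordinal (leq_ltn_trans le_ij lt_jn))) dev_noninc.
  + by move=> i /andP[].
  + rewrite (admissibleE z) in adm_z; apply: leq_trans adm_z.
    apply: leq_sum => i _; rewrite /u -!tnth_nth.
    by case: (tnth z i); case: (tnth y i).
  + by move=> i lt_in; rewrite (dE (Ordinal lt_in)) ltW.
- pose z' := [tuple greedy g (nth false y) i | i < n].
  have -> : \sum_(i < n) d i *+ greedy g (nth false y) i =
      \sum_(i < n) tnth (max_deviation I) i *+ (tnth z' i && tnth y i).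
    apply: eq_bigr => i _; rewrite tnth_mktuple dE /greedy -tnth_nth.
    by case: (tnth y i) => //=; rewrite andbT.
  move: (max_y z'); rewrite -scenario_costE; apply.
  rewrite admissibleE; under eq_bigr do rewrite tnth_mktuple.
  by rewrite card_greedy geq_minr.
Qed.
End WorstCase.

(** * The dynamic program *)

(* The choice for an item is the pair of its bits in x and y. *)
Definition choice_both (o : bool * bool) : nat := o.1 && o.2.
Definition choice_x (o : bool * bool) : nat := o.1 && ~~ o.2.
Definition choice_y (o : bool * bool) : nat := ~~ o.1 && o.2.

Lemma choice_sum_le1 o : (choice_both o + choice_x o + choice_y o <= 1)%N.
Proof. by case: o => [[] []]. Qed.

Definition count_choices (q : bool * bool -> nat) (f : nat -> bool * bool) i : nat :=
  (\sum_(j < i) q (f j))%N.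

Section Recurrence.
Variables (C c d : nat -> rat) (g : nat).

Definition choice_cost i (o : bool * bool) (m : nat) : rat :=
  C i *+ o.1 + (c i + d i *+ (m <= g)%N) *+ o.2.

(* The number m of y-items up to and including item i tells whether item i
   deviates: the deviations are non-increasing, so the first g items of y do. *)
Definition selection_cost (f : nat -> bool * bool) i : rat :=
  \sum_(j < i) choice_cost j (f j)
     (count_choices choice_both f j.+1 + count_choices choice_y f j.+1).

Lemma count_choicesS q f i :
  count_choices q f i.+1 = (count_choices q f i + q (f i))%N.
Proof. by rewrite /count_choices big_ord_recr. Qed.

Lemma selection_costS f i : selection_cost f i.+1 = selection_cost f i +
  choice_cost i (f i) (count_choices choice_both f i.+1 + count_choices choice_y f i.+1).
Proof. by rewrite /selection_cost big_ord_recr. Qed.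

Lemma count_choices_le f i : (count_choices choice_both f i +
  count_choices choice_x f i + count_choices choice_y f i <= i)%N.
Proof.
elim: i => [|i IHi]; first by rewrite /count_choices !big_ord0.
by rewrite !count_choicesS; have := choice_sum_le1 (f i); lia.
Qed.

Variable V : nat -> nat -> nat -> nat -> rat.

(* A selection of the first i items with the three prescribed cardinalities
   exists as soon as their sum is at most i, so no infinite values are needed. *)
Definition allowed i a b e (o : bool * bool) : bool :=
  [&& choice_both o <= a, choice_x o <= b, choice_y o <= e &
   a + b + e <= i + (choice_both o + choice_x o + choice_y o)]%N.

(** The counts are those of the cell on level [i.+1], so [a + e] already includes item [i] if it is
    in y. The truncated subtractions are exact under [allowed]. *)
Definition candidate i a b e (o : bool * bool) : rat :=
  V i (a - choice_both o) (b - choice_x o) (e - choice_y o) +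
  choice_cost i o (a + e).

Definition bellman i a b e (o : bool * bool) : Prop :=
  [/\ allowed i a b e o, V i.+1 a b e = candidate i a b e o
    & forall o', allowed i a b e o' -> V i.+1 a b e <= candidate i a b e o'].

(** The prefix counts of any selection form a path of allowed transitions, along which the Bellman
    inequalities add up. That the value is attained is left to the traceback. *)
Lemma bellman_lower_bound n A B f : V 0 0 0 0 = 0 ->
  (forall i a b e, (i < n)%N -> (a <= A)%N -> (b <= B)%N -> (e <= B)%N ->
     (a + b + e <= i.+1)%N -> exists o, bellman i a b e o) ->
  forall i, (i <= n)%N ->
    (count_choices choice_both f i <= A)%N ->
    (count_choices choice_x f i <= B)%N ->
    (count_choices choice_y f i <= B)%N ->
  V i (count_choices choice_both f i) (count_choices choice_x f i)
      (count_choices choice_y f i) <= selection_cost f i.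
Proof.
move=> V0 opt; elim=> [|i IHi] le_in.
  by rewrite /count_choices /selection_cost !big_ord0 V0.
move=> leA leB leB'; have le_i := count_choices_le f i.
have [|o [_ _ min_o]] := opt i _ _ _ le_in leA leB leB'.
  exact: count_choices_le.
rewrite !count_choicesS in leA leB leB'.
apply: le_trans (min_o (f i) _) _.
  by rewrite /allowed !count_choicesS; apply/and4P; split; lia.
rewrite /candidate selection_costS !count_choicesS !addnK lerD2r.
by apply: IHi; lia.
Qed.

End Recurrence.

(** * The objective as an additive selection cost *)

Section Objective.
Variables (n : nat) (I : instance n) (g : nat).
Hypothesis valid : valid_instance I.
Hypothesis weightE :
  forall i : 'I_n, tnth (weight I) i = 1 / tnth (max_deviation I) i.
Hypothesis dev_noninc : forall i j : 'I_n, (i <= j)%N ->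
  tnth (max_deviation I) j <= tnth (max_deviation I) i.
Hypothesis budget_floor : forall m : nat, (m%:R <= budget I) = (m <= g)%N.

Lemma objectiveE (x y : n.-tuple bool) (f : nat -> bool * bool) :
  (forall i : 'I_n, f i = (tnth x i, tnth y i)) ->
  objective I x y = selection_cost (nth 0 (fixed_cost I))
    (nth 0 (nominal_cost I)) (nth 0 (max_deviation I)) g f n.
Proof.
move=> fE; rewrite /objective (worst_case_greedy valid weightE dev_noninc budget_floor).
rewrite -!big_split /=; apply: eq_bigr => i _.
rewrite fE /choice_cost /= -!tnth_nth addrA mulr_natr mulrnDl addrA -mulrnA.
congr (_ + _ *+ _); rewrite !count_choicesS fE /greedy -tnth_nth.
rewrite -[RHS]/(nat_of_bool _ * nat_of_bool _)%N mulnb andbC.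
case yi: (tnth y i); rewrite ?andbF //=; congr nat_of_bool.
(* With item [i] in y, the count through [i] exceeds [rank] by one, so comparing it with [g] by [<=]
   agrees with [rank < g]. *)
have -> : rank (nth false y) i =
    (count_choices choice_both f i + count_choices choice_y f i)%N.
  rewrite /rank /count_choices -big_split /=; apply: eq_bigr => j _.
  have lt_jn : (j < n)%N by apply: ltn_trans (ltn_ord j) (ltn_ord i).
  rewrite -[nat_of_ord j]/(nat_of_ord (Ordinal lt_jn)) fE -tnth_nth.
  by rewrite /choice_both /choice_y /=; case: (tnth x _); case: (tnth y _).
by rewrite /choice_both /choice_y /=; case: (tnth x i) => /=; lia.
Qed.

End Objective.

(** * Total correctness with time bounds *)

(** [T] bounds the time from above only, so that both branches of a conditional and all iterations
    of a loop can be charged alike. *)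
Definition wp (c : com) (T : nat) (Q : state -> Prop) (s : state) : Prop :=
  exists s' t, [/\ exec c s s' t, (t <= T)%N & Q s'].

Lemma wp_weaken c T T' (Q Q' : state -> Prop) s :
  (T <= T')%N -> (forall s', Q s' -> Q' s') -> wp c T Q s -> wp c T' Q' s.
Proof.
move=> leT QQ' [s' [t [ex le_t Qs']]]; exists s', t; split => //.
  exact: leq_trans leT.
exact: QQ'.
Qed.

Lemma wp_le c T T' (Q : state -> Prop) s : (T <= T')%N -> wp c T Q s -> wp c T' Q s.
Proof. by move/wp_weaken; exact. Qed.

Lemma wp_skip (Q : state -> Prop) s : Q s -> wp Skip 1 Q s.
Proof. by move=> Qs; exists s, 1%N; split => //; exact: ExecSkip. Qed.

Definition set_int (s : state) a j v := State (update (ints s) a j v) (nums s).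
Definition set_num (s : state) a j v := State (ints s) (update (nums s) a j v).

Lemma ints_set_int s k q v : ints (set_int s k q v) k q = v.
Proof. by rewrite /= /update !eqxx. Qed.

Lemma ints_incr s v j :
  ints s v 0 = j -> ints (set_int s v 0 (ints s v 0 + 1)) v 0 = j.+1.
Proof. by move=> <-; rewrite ints_set_int addn1. Qed.

Lemma wp_iset a i e (Q : state -> Prop) s :
  Q (set_int s a (ieval s i) (ieval s e)) ->
  wp (ISet a i e) (icost i + icost e).+1 Q s.
Proof. by move=> Qs; do 2!eexists; split; [exact: ExecISet| |]. Qed.

Lemma wp_qset a i e (Q : state -> Prop) s :
  Q (set_num s a (ieval s i) (qeval s e)) ->
  wp (QSet a i e) (icost i + qcost e).+1 Q s.
Proof. by move=> Qs; do 2!eexists; split; [exact: ExecQSet| |]. Qed.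

Lemma wp_seq c1 c2 T1 T2 (Q : state -> Prop) s :
  wp c1 T1 (wp c2 T2 Q) s -> wp (Seq c1 c2) (T1 + T2) Q s.
Proof.
move=> [s1 [t1 [ex1 le1 [s2 [t2 [ex2 le2 Qs]]]]]].
exists s2, (t1 + t2)%N; split => //; last exact: leq_add.
exact: ExecSeq ex1 ex2.
Qed.

Lemma wp_seq_mid c1 c2 T1 T2 (R Q : state -> Prop) s :
  wp c1 T1 R s -> (forall s', R s' -> wp c2 T2 Q s') ->
  wp (Seq c1 c2) (T1 + T2) Q s.
Proof.
by move=> wp1 wp2; apply: wp_seq; exact: wp_weaken (leqnn _) wp2 wp1.
Qed.

Lemma wp_if b c1 c2 T1 T2 (Q : state -> Prop) s :
  (beval s b -> wp c1 T1 Q s) -> (~~ beval s b -> wp c2 T2 Q s) ->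
  wp (If b c1 c2) (bcost b + maxn T1 T2).+1 Q s.
Proof.
case: (boolP (beval s b)) => [bs /(_ isT) H _ | bs _ /(_ isT) H].
- case: H => s' [t [ex le_t Qs]]; exists s', (bcost b + t).+1.
  by split; [exact: ExecIfTrue | rewrite ltnS leq_add2l leq_max le_t | ].
- case: H => s' [t [ex le_t Qs]]; exists s', (bcost b + t).+1.
  by split; [exact: ExecIfFalse | rewrite ltnS leq_add2l leq_max le_t orbT | ].
Qed.

Definition var a := IGet a (IConst 0).

Definition For v e c :=
  Seq (ISet v (IConst 0) (IConst 0))
    (While (BLeI (IAdd (var v) (IConst 1)) e)
       (Seq c (ISet v (IConst 0) (IAdd (var v) (IConst 1))))).

(* Paid for a whole loop, once per iteration; this also covers the
   initialization and the final test. *)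
Definition for_overhead e := (2 * icost e + 30)%N.

(** The bound [e] is evaluated anew at each test, so the invariant has to preserve its value as well
    as the counter. Positivity of [N] lets the one-time costs be charged to the iterations. *)
Lemma wp_for v e c N T (Inv : nat -> state -> Prop) s :
  (0 < N)%N ->
  Inv 0%N (set_int s v 0 0) ->
  (forall j s', Inv j s' -> ints s' v 0 = j /\ ieval s' e = N) ->
  (forall j s', (j < N)%N -> Inv j s' ->
     wp c T (fun s'' => Inv j.+1 (set_int s'' v 0 (ints s'' v 0 + 1))) s') ->
  wp (For v e c) (N * (T + for_overhead e)) (Inv N) s.
Proof.
move=> N_gt0 inv0 InvE body.
have loop m j s' : (j + m = N)%N -> Inv j s' ->
    wp (While (BLeI (IAdd (var v) (IConst 1)) e)
       (Seq c (ISet v (IConst 0) (IAdd (var v) (IConst 1)))))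
     (m * (T + icost e + 14) + icost e + 10) (Inv N) s'.
  elim: m j s' => [|m IHm] j s' jm inv; have [vE eE] := InvE _ _ inv.
    exists s'; eexists; split; first by apply: ExecWhileFalse; rewrite /= vE eE; lia.
      by rewrite /=; lia.
    by have -> : N = j by lia.
  have [|s1 [t1 [ex1 le1 inv1]]] := body j s' _ inv; first by lia.
  have [|s2 [t2 [ex2 le2 inv2]]] := IHm j.+1 _ _ inv1; first by lia.
  exists s2; eexists; split; last exact: inv2.
    apply: ExecWhileTrue ex2; first by rewrite /= vE eE; lia.
    apply: ExecSeq ex1 _; exact: ExecISet.
  by rewrite /=; nia.
apply: (@wp_weaken _ (3 + (N * (T + icost e + 14) + icost e + 10)) _ (Inv N)) => //.
  by rewrite /for_overhead; nia.
by apply: wp_seq; apply: wp_iset; exact: loop inv0.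
Qed.

(** * The program *)

Definition encode M i a b e : nat := (((i * M + a) * M + b) * M + e)%N.

(** Successive division by [M] recovers the three counts as digits; the level is the leading
    quotient and may be arbitrarily large. *)
Lemma encode_inj M i a b e i' a' b' e' :
  (a < M)%N -> (b < M)%N -> (e < M)%N -> (a' < M)%N -> (b' < M)%N -> (e' < M)%N ->
  encode M i a b e = encode M i' a' b' e' -> [/\ i = i', a = a', b = b' & e = e'].
Proof.
have digits q r q' r' : (r < M)%N -> (r' < M)%N ->
    (q * M + r = q' * M + r')%N -> q = q' /\ r = r'.
  move=> rM rM' eq_qr; have M_gt0 : (0 < M)%N by lia.
  have:= congr1 (fun z => z %/ M)%N eq_qr; rewrite !divnMDl // !divn_small // !addn0.
  by move=> eq_q; split=> //; lia.
move=> aM bM eM aM' bM' eM'.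
by move=> /digits[]// /digits[]// /digits[]// -> -> -> ->.
Qed.

Definition var_n := IGet 0 (IConst 0).
(* Integer arrays: 3 and 4 the decisions, 5 a flag, 6 to 9 the indices of the
   current cell, 10 the best target.  Number arrays: 6 the table of values,
   7 the numbers 0, ..., 2n, 8 the current candidate, 9 the current deviation. *)
Definition encode_expr i a b e :=
  let M := IAdd var_n (IConst 1) in
  IAdd (IMul (IAdd (IMul (IAdd (IMul i M) a) M) b) M) e.

Definition cell_expr :=
  encode_expr (IAdd (var 6) (IConst 1)) (var 7) (var 8) (var 9).

Definition allowed_expr (o : bool * bool) : bexpr :=
  let q1 := IConst (choice_both o) in
  let q2 := IConst (choice_x o) in
  let q3 := IConst (choice_y o) in
  BAnd (BLeI q1 (var 7)) (BAnd (BLeI q2 (var 8)) (BAnd (BLeI q3 (var 9))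
    (BLeI (IAdd (IAdd (var 7) (var 8)) (var 9))
          (IAdd (var 6) (IAdd (IAdd q1 q2) q3))))).

Definition candidate_expr (o : bool * bool) : qexpr :=
  QAdd (QGet 6 (encode_expr (var 6) (ISub (var 7) (IConst (choice_both o)))
                  (ISub (var 8) (IConst (choice_x o)))
                  (ISub (var 9) (IConst (choice_y o)))))
    (QAdd (if o.1 then QGet 0 (var 6) else QConst 0)
          (if o.2 then QAdd (QGet 1 (var 6)) (QGet 9 (IConst 0)) else QConst 0)).

(** The flag in integer array 5 replaces an infinite initial value: the first allowed choice is
    stored without comparison. *)
Definition try_choice (o : bool * bool) : com :=
  If (allowed_expr o)
    (Seq (QSet 8 (IConst 0) (candidate_expr o))
    (If (BAnd (BLeI (IConst 1) (var 5)) (BLeQ (QGet 6 cell_expr) (QGet 8 (IConst 0))))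
       Skip
       (Seq (QSet 6 cell_expr (QGet 8 (IConst 0)))
       (Seq (ISet 3 cell_expr (IConst o.1))
       (Seq (ISet 4 cell_expr (IConst o.2))
            (ISet 5 (IConst 0) (IConst 1)))))))
    Skip.

(** Entry [a + e] of number array 7 is the rational [a + e], so the first test decides [a + e <= g]
    without computing [g]. *)
Definition fill_cell : com :=
  Seq (ISet 5 (IConst 0) (IConst 0))
  (Seq (If (BLeQ (QGet 7 (IAdd (var 7) (var 9))) (QGet 4 (IConst 0)))
         (QSet 9 (IConst 0) (QGet 2 (var 6)))
         (QSet 9 (IConst 0) (QConst 0)))
  (Seq (try_choice (false, false))
  (Seq (try_choice (false, true))
  (Seq (try_choice (true, false))
       (try_choice (true, true)))))).

(** * Correctness of filling one cell *)

Section FillCell.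
Variables (s0 : state) (n g i a b e : nat).
Hypothesis n_s0 : ints s0 0 0 = n.
Hypothesis scalars_s0 : [/\ ints s0 6 0 = i, ints s0 7 0 = a, ints s0 8 0 = b & ints s0 9 0 = e].
Hypothesis rational_s0 : nums s0 7 (a + e) = (a + e)%:R.
Hypothesis budget_s0 : forall m : nat, (m%:R <= nums s0 4 0%N) = (m <= g)%N.
Hypothesis bounds : [/\ (i < n)%N, (a <= n)%N, (b <= n)%N & (e <= n)%N].

Let cell := encode n.+1 i.+1 a b e.

Definition same_outside (s : state) : Prop :=
  [/\ [/\ ints s 0 = ints s0 0, ints s 1 = ints s0 1 & ints s 2 = ints s0 2],
      [/\ ints s 6 = ints s0 6, ints s 7 = ints s0 7, ints s 8 = ints s0 8 & ints s 9 = ints s0 9],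
      [/\ nums s 0 = nums s0 0, nums s 1 = nums s0 1, nums s 2 = nums s0 2,
          nums s 4 = nums s0 4 & nums s 7 = nums s0 7]
    & forall q, q <> cell -> [/\ ints s 3 q = ints s0 3 q, ints s 4 q = ints s0 4 q
         & nums s 6 q = nums s0 6 q]].

Let table (s : state) i a b e := nums s 6 (encode n.+1 i a b e).
Let cand := candidate (nums s0 0) (nums s0 1) (nums s0 2) g (table s0) i a b e.

Definition best_among (L : seq (bool * bool)) (s : state) : Prop :=
  [/\ same_outside s, nums s 9 0 = nums s0 2 i *+ (a + e <= g)%N &
     (ints s 5 0 = 0%N /\ (forall o, o \in L -> ~~ allowed i a b e o)) \/
     (ints s 5 0 = 1%N /\ exists o,
        [/\ allowed i a b e o, ints s 3 cell = o.1, ints s 4 cell = o.2,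
            nums s 6 cell = cand o &
            forall o', o' \in L -> allowed i a b e o' -> nums s 6 cell <= cand o'])].

Lemma wp_try_choice L o s : best_among L s ->
  wp (try_choice o) 1000 (best_among (o :: L)) s.
Proof.
have [i6 a7 b8 e9] := scalars_s0; have [lt_in le_an le_bn le_en] := bounds.
move=> [frame dev best]; have [[f0 f1 f2] [f6 f7 f8 f9] [g0 g1 g2 g4 g7] fcell] := frame.
have cellE s' : ints s' 0 = ints s0 0 -> ints s' 6 = ints s0 6 ->
    ints s' 7 = ints s0 7 -> ints s' 8 = ints s0 8 -> ints s' 9 = ints s0 9 ->
    ieval s' cell_expr = cell.
  by move=> h0 h6 h7 h8 h9; rewrite /= h0 h6 h7 h8 h9 n_s0 i6 a7 b8 e9 !addn1.
have guardE : beval s (allowed_expr o) = allowed i a b e o.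
  by rewrite /= f6 f7 f8 f9 i6 a7 b8 e9.
apply: wp_le; last first.
  apply: wp_if; rewrite guardE => allow_o; last first.
    apply: wp_skip; split=> //; case: best => [[fl none]|[fl [o1 [? ? ? ? best]]]].
      by left; split=> // o'; rewrite inE => /predU1P[->|/none].
    right; split=> //; exists o1; split=> // o'; rewrite inE.
    by move=> /predU1P[->|/best//]; rewrite (negPf allow_o).
  apply: wp_seq; apply: wp_qset.
  set v := qeval s _.
  have vE : v = cand o.
    (* The candidate reads level [i] while the cell being written lies on level [i.+1], so the entry
       read is still that of [s0]. *)
    have [|_ _ Vo] := fcell (encode n.+1 i (a - choice_both o) (b - choice_x o) (e - choice_y o)).
      by case/encode_inj; lia.
    rewrite /v /cand /candidate /choice_cost.
    congr (_ + _); first by rewrite /= f0 f6 f7 f8 f9 n_s0 i6 a7 b8 e9 !addn1.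
    by case: {guardE allow_o v Vo} o => [[] []]; rewrite /= ?g0 ?g1 ?f6 ?i6 ?dev ?mulr1n ?mulr0n.
  set s1 := set_num _ _ _ _.
  have cell_s1 : ieval s1 cell_expr = cell by exact: cellE.
  have keepE : beval s1 (BAnd (BLeI (IConst 1) (var 5))
      (BLeQ (QGet 6 cell_expr) (QGet 8 (IConst 0)))) =
      (0 < ints s 5 0)%N && (nums s 6 cell <= v) by rewrite -cell_s1.
  apply: wp_if; rewrite keepE; [move=> /andP[fl better] | move=> worse].
    apply: wp_skip; split=> //.
    case: best => [[]|[fl1 [o1 [? ? ? ? best]]]]; first by lia.
    right; split=> //; exists o1; split=> // o'; rewrite inE.
    by move=> /predU1P[-> _|/best//]; rewrite -vE.
  apply: wp_seq; apply: wp_qset.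
  apply: wp_seq; apply: wp_iset.
  apply: wp_seq; apply: wp_iset.
  apply: wp_iset.
  rewrite !cellE //; set s2 := set_int _ 5 _ _.
  have upd_cell T (m : nat -> nat -> T) k u : update m k cell u k cell = u.
    by rewrite /update !eqxx.
  have v_s2 : nums s2 6 cell = v by exact: upd_cell.
  split=> //.
    split=> // q /eqP/negPf neq_q; have [|<- <- <-] := fcell q; first exact/eqP/negbT.
    by rewrite /= /update neq_q !andbF.
  right; split=> //; exists o; rewrite v_s2; split=> //; try exact: upd_cell.
  move=> o'; rewrite inE => /predU1P[-> _|]; first by rewrite vE.
  case: best => [[fl none] /none/negPf -> //|[fl [o1 [? ? ? ? best]]] /best le_best /le_best].
  by move: worse; rewrite fl /= -ltNge => /ltW; exact: le_trans.
(* For a concrete choice the accumulated time is a numeral, and the bound is checked by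
   computation. *)
- by case: o {guardE} => [[] []].
Qed.

Definition cell_ok (s : state) : Prop := (a + b + e <= i.+1)%N -> exists o : bool * bool,
  [/\ ints s 3 cell = o.1, ints s 4 cell = o.2 &
      bellman (nums s0 0) (nums s0 1) (nums s0 2) g (table s) i a b e o].

Lemma wp_fill_cell :
  wp fill_cell 5000 (fun s => same_outside s /\ cell_ok s) s0.
Proof.
have [i6 a7 b8 e9] := scalars_s0; have [lt_in le_an le_bn le_en] := bounds.
apply: (@wp_weaken _ 5000 _ (best_among
    [:: (true, true); (true, false); (false, true); (false, false)])) => // [s|].
  move=> [frame dev best]; split=> // le_i; have [_ _ _ fcell] := frame.
  have candE (o : bool * bool) : candidate (nums s0 0) (nums s0 1) (nums s0 2) g (table s) i a b e o = cand o.
    rewrite /cand /candidate /table; congr (_ + _).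
    by have [|//] := fcell (encode n.+1 i (a - choice_both o) (b - choice_x o) (e - choice_y o));
      first by case/encode_inj; lia.
  case: best => [[_ none]|[_ [o [? ? ? Vcell best]]]].
    (* Some choice is always allowed: skipping the item if [a + b + e <= i], and otherwise any
       choice that lowers a positive count. *)
    exfalso; have:= none (true, true) isT; have:= none (true, false) isT.
    have:= none (false, true) isT; have:= none (false, false) isT.
    by rewrite /allowed /choice_both /choice_x /choice_y /=; lia.
  exists o; split=> //; split=> //; first by rewrite candE -Vcell.
  by move=> o'; rewrite candE; apply: best; case: o' => [[] []].
apply: wp_le; last first.
  apply: wp_seq; apply: wp_iset; set s1 := set_int _ _ _ _.
  have devE : beval s1 (BLeQ (QGet 7 (IAdd (var 7) (var 9))) (QGet 4 (IConst 0))) = (a + e <= g)%N.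
    rewrite -[LHS]/(nums s0 7 (ints s0 7 0 + ints s0 9 0)%N <= nums s0 4 0%N).
    by rewrite a7 e9 rational_s0 budget_s0.
  apply: (@wp_seq_mid _ _ 100 _ (best_among [::])) => [|s2 best2].
    apply: wp_le; last first.
      apply: wp_if; rewrite devE => le_g; apply: wp_qset; split=> //; try by left.
        by rewrite -[LHS]/(nums s0 2 (ints s0 6 0)) i6 le_g.
      by rewrite (negPf le_g).
    by [].
  apply: wp_seq_mid (wp_try_choice _ best2) _ => s3 best3.
  apply: wp_seq_mid (wp_try_choice _ best3) _ => s4 best4.
  apply: wp_seq_mid (wp_try_choice _ best4) _ => s5 best5.
  exact: wp_try_choice.
by [].
Qed.

End FillCell.

(** Worst-case time of loop-free code, in the form produced by the [wp] rules. It names times that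
    depend on the abstract expressions [ea] and [ee] and hence are not numerals. *)
Fixpoint straight_time (c : com) : nat :=
  match c with
  | Skip => 1
  | ISet _ i e => (icost i + icost e).+1
  | QSet _ i e => (icost i + qcost e).+1
  | Seq c1 c2 => straight_time c1 + straight_time c2
  | If b c1 c2 => (bcost b + maxn (straight_time c1) (straight_time c2)).+1
  | While _ _ => 0
  end.

(** * The program common to both problems *)

Section Program.
(* The sizes of X :&: Y, X :\: Y and Y :\: X are bounded by eA, eB and eB;
   the j-th final state, j <= eB, is (ea j, j, ee j). *)
Variables (eA eB : iexpr) (ea ee : iexpr -> iexpr).

(** Makes entry m the rational m, since an integer cannot be converted directly. The range up to 2n
    covers [a + e], both counts being at most n. *)
Definition rank_loop : com :=
  For 6 (IMul (IConst 2) var_n)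
    (QSet 7 (IAdd (var 6) (IConst 1)) (QAdd (QGet 7 (var 6)) (QConst 1))).

Definition fill_loop : com :=
  For 6 var_n
    (For 7 (IAdd eA (IConst 1))
      (For 8 (IAdd eB (IConst 1))
        (For 9 (IAdd eB (IConst 1)) fill_cell))).

Definition target_expr j := encode_expr var_n (ea j) j (ee j).

(** The size test rejects final states that no selection of n items reaches, whose cells carry no
    meaningful value. The initial candidate 0 passes it by [target0]. *)
Definition select_target : com :=
  If (BAnd (BLeI (IAdd (IAdd (ea (var 6)) (var 6)) (ee (var 6))) var_n)
        (BNot (BLeQ (QGet 6 (target_expr (var 10))) (QGet 6 (target_expr (var 6))))))
     (ISet 10 (IConst 0) (var 6))
     Skip.

(** When the counter is t, level n - t holds the decision on item n - t - 1. The products of bits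
    are [choice_both], [choice_x] and [choice_y] of that decision. *)
Definition trace_item : com :=
  let item := ISub (ISub var_n (var 6)) (IConst 1) in
  let cell := encode_expr (ISub var_n (var 6)) (var 7) (var 8) (var 9) in
  let x := IGet 1 item in
  let y := IGet 2 item in
  Seq (ISet 1 item (IGet 3 cell))
  (Seq (ISet 2 item (IGet 4 cell))
  (Seq (ISet 7 (IConst 0) (ISub (var 7) (IMul x y)))
  (Seq (ISet 8 (IConst 0) (ISub (var 8) (IMul x (ISub (IConst 1) y))))
       (ISet 9 (IConst 0) (ISub (var 9) (IMul (ISub (IConst 1) x) y)))))).

Definition dp_program : com :=
  Seq rank_loop
  (Seq fill_loop
  (Seq (ISet 10 (IConst 0) (IConst 0))
  (Seq (For 6 (IAdd eB (IConst 1)) select_target)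
  (Seq (QSet 5 (IConst 0) (QGet 6 (target_expr (var 10))))
  (Seq (ISet 7 (IConst 0) (ea (var 10)))
  (Seq (ISet 8 (IConst 0) (var 10))
  (Seq (ISet 9 (IConst 0) (ee (var 10)))
       (For 6 var_n trace_item)))))))).

Variables (n g A B : nat) (params : seq nat) (C c d : nat -> rat) (ta te : nat -> nat).
Hypothesis n_gt0 : (0 < n)%N.
Hypothesis n_param : nth 0%N params 0 = n.
Hypotheses (le_An : (A <= n)%N) (le_Bn : (B <= n)%N).
Hypothesis eAE : forall s, ints s 0 = nth 0%N params -> ieval s eA = A.
Hypothesis eBE : forall s, ints s 0 = nth 0%N params -> ieval s eB = B.
Hypothesis eaE : forall s q, ints s 0 = nth 0%N params -> ieval s (ea q) = ta (ieval s q).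
Hypothesis eeE : forall s q, ints s 0 = nth 0%N params -> ieval s (ee q) = te (ieval s q).
Hypothesis target_bounds : forall j, (j <= B)%N -> (ta j <= A)%N && (te j <= B)%N.
Hypothesis target0 : (ta 0 + te 0 <= n)%N.

Definition input_ok (s : state) : Prop :=
  [/\ ints s 0 = nth 0%N params,
      [/\ nums s 0 = C, nums s 1 = c & nums s 2 = d],
      forall m : nat, (m%:R <= nums s 4 0%N) = (m <= g)%N
    & nums s 6 0 = 0].

Definition ranks_upto N (s : state) : Prop :=
  forall m, (m <= N)%N -> nums s 7 m = m%:R.

Lemma wp_rank_loop s : input_ok s -> nums s 7 0 = 0 ->
  wp rank_loop (2 * n * (10 + for_overhead (IMul (IConst 2) var_n)))
    (fun s' => input_ok s' /\ ranks_upto (2 * n) s') s.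
Proof.
move=> ok0 r0.
pose Inv j (s : state) := [/\ input_ok s, ranks_upto j s & ints s 6 0 = j].
have := @wp_for 6 (IMul (IConst 2) var_n) _ (2 * n) 10 Inv s _ _ _ _.
move=> wpf; apply: wp_weaken (leqnn _) _ (wpf _ _ _ _ _) => //.
- by move=> s' [].
- by lia.
- by split=> // m; rewrite leqn0 => /eqP->.
- by move=> j s' [[ok _ _ _] _ ->]; rewrite /= ok n_param.
move=> j s' _ [ok ranks j6]; apply: wp_qset; split=> //; last first.
  by rewrite -[LHS]/(ints s' 6 0 + 1)%N j6 addn1.
move=> m le_m; rewrite /= /update /= j6 addn1.
case: eqP => [->|ne]; first by rewrite /= ranks // -[X in _ + X]/(1%:R) -natrD addn1.
by rewrite /= ranks //; lia.
Qed.

(** * Filling the table *)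

Definition table_cell_ok (s : state) i a b e : Prop :=
  (a + b + e <= i.+1)%N -> exists o : bool * bool,
  [/\ ints s 3 (encode n.+1 i.+1 a b e) = o.1,
      ints s 4 (encode n.+1 i.+1 a b e) = o.2 &
      bellman C c d g (fun i a b e => nums s 6 (encode n.+1 i a b e)) i a b e o].

Definition lex_before i a b e i' a' b' e' : Prop :=
  (i < i' \/ i = i' /\ (a < a' \/ a = a' /\ (b < b' \/ b = b' /\ e < e')))%N.

(** A single invariant for the four nested loops, whose counters act as one lexicographic counter;
    [filled n 0 0 0] says that the whole table is done. *)
Definition filled i a b e (s : state) : Prop :=
  [/\ input_ok s, ranks_upto (2 * n) s & forall i' a' b' e',
    (i' < n)%N -> (a' <= A)%N -> (b' <= B)%N -> (e' <= B)%N ->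
    lex_before i' a' b' e' i a b e -> table_cell_ok s i' a' b' e'].

Lemma wp_fill_step i a b e s :
  filled i a b e s -> (i < n)%N -> (a <= A)%N -> (b <= B)%N -> (e <= B)%N ->
  [/\ ints s 6 0 = i, ints s 7 0 = a, ints s 8 0 = b & ints s 9 0 = e] ->
  wp fill_cell 5000 (fun s' => filled i a b e.+1 s' /\
    [/\ ints s' 6 0 = i, ints s' 7 0 = a, ints s' 8 0 = b & ints s' 9 0 = e]) s.
Proof.
move=> [ok ranks done] lt_in le_aA le_bB le_eB vars.
have [ok0 [okC okc okd] okb ok6] := ok.
have := @wp_fill_cell s n g i a b e.
move=> wpf; apply: wp_weaken (leqnn _) _ (wpf _ _ _ _ _) => //.
- move=> s' [[[f0 _ _] [-> -> -> ->] [g0 g1 g2 g4 g7] fcell] cell]; split=> //; split.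
  + rewrite /input_ok f0 g0 g1 g2 g4; split=> //.
    have [|_ _ -> //] := fcell (encode n.+1 0 0 0 0); first by case/encode_inj; lia.
  + by move=> m le_m; rewrite g7 ranks.
  + move=> i' a' b' e' lt_i'n le_a'A le_b'B le_e'B before.
    have [new|old] : (i' = i /\ a' = a /\ b' = b /\ e' = e) \/ lex_before i' a' b' e' i a b e.
      by rewrite /lex_before in before *; lia.
      case: new => -> [-> [-> ->]]; rewrite /table_cell_ok -okC -okc -okd; exact: cell.
    move=> le_i'; have [//|//|//|//|//|//|o [o3 o4 [o_ok oE o_min]]] := done i' a' b' e'.
    (* An earlier cell draws its candidates from a level [i' <= i], and the write hits level [i.+1],
       so its Bellman equation survives. *)
    have old_cell a1 b1 e1 : (a1 <= n)%N -> (b1 <= n)%N -> (e1 <= n)%N ->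
        nums s' 6 (encode n.+1 i' a1 b1 e1) = nums s 6 (encode n.+1 i' a1 b1 e1).
      move=> *; have [|_ _ ->//] := fcell (encode n.+1 i' a1 b1 e1).
      by rewrite /lex_before in old; case/encode_inj; lia.
    have [|h3 h4 h6] := fcell (encode n.+1 i'.+1 a' b' e').
      by rewrite /lex_before in old; case/encode_inj; lia.
    have candE o' : candidate C c d g (fun i a b e => nums s' 6 (encode n.+1 i a b e)) i' a' b' e' o'
       = candidate C c d g (fun i a b e => nums s 6 (encode n.+1 i a b e)) i' a' b' e' o'.
      by rewrite /candidate old_cell //; lia.
    exists o; rewrite h3 h4; split=> //; split=> //; rewrite h6.
      by rewrite candE.
    by move=> o'; rewrite candE; exact: o_min.
- by rewrite ok0.
- by apply: ranks; lia.
- by split=> //; lia.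
Qed.

Definition fill_time : nat :=
  n * (A.+1 * (B.+1 * (B.+1 * (5000 + for_overhead (IAdd eB (IConst 1)))
    + for_overhead (IAdd eB (IConst 1))) + for_overhead (IAdd eA (IConst 1)))
    + for_overhead var_n).

Lemma wp_fill_loop s : input_ok s -> ranks_upto (2 * n) s ->
  wp fill_loop fill_time (filled n 0 0 0) s.
Proof.
move=> ok ranks.
pose InvI i s := filled i 0 0 0 s /\ ints s 6 0 = i.
pose InvA i a s := filled i a 0 0 s /\ [/\ ints s 6 0 = i & ints s 7 0 = a].
pose InvB i a b s := filled i a b 0 s /\
  [/\ ints s 6 0 = i, ints s 7 0 = a & ints s 8 0 = b].
pose InvE i a b e s := filled i a b e s /\
  [/\ ints s 6 0 = i, ints s 7 0 = a, ints s 8 0 = b & ints s 9 0 = e].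
(* Used for the carries: within the bounds, the cells before [(i, a, b, B.+1)] include all those
   before [(i, a, b.+1, 0)], and likewise for the outer counters. *)
have next i a b e i' a' b' e' s1 :
    (forall i1 a1 b1 e1, (i1 < n -> a1 <= A -> b1 <= B -> e1 <= B ->
      lex_before i1 a1 b1 e1 i' a' b' e' -> lex_before i1 a1 b1 e1 i a b e)%N) ->
    filled i a b e s1 -> filled i' a' b' e' s1.
  by move=> sub [? ? done]; split=> // i1 a1 b1 e1 *; apply: done => //; exact: sub.
have boundE s1 q N : input_ok s1 ->
    (forall s, ints s 0 = nth 0%N params -> ieval s q = N) ->
    ieval s1 (IAdd q (IConst 1)) = N.+1.
  by move=> [ok0 _ _ _] qE; rewrite /= qE // addn1.
apply: (@wp_weaken _ fill_time _ (InvI n)) => // [s1 []//|].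
apply: wp_for => // [||i s1 lt_in [F6 i6]].
- by split=> //; split=> // i a b e _ _ _ _; rewrite /lex_before; lia.
- by move=> i s1 [[[ok0 _ _ _] _ _] i6]; rewrite /= ok0 n_param.
apply: (@wp_weaken _ _ _ (InvA i A.+1) _ _ (leqnn _)) => // [s2 [F2 [? ?]]|].
  split; last exact: ints_incr.
  by apply: next F2 => i1 a1 b1 e1; rewrite /lex_before; lia.
rewrite /fill_loop /fill_time; apply: wp_for => // [|a s2 lt_aA [F7 [i7 a7]]].
- by move=> a s2 [F [? ?]]; split=> //; apply: boundE; [case: F | exact: eAE].
apply: (@wp_weaken _ _ _ (InvB i a B.+1) _ _ (leqnn _)) => // [s3 [F3 [? ? ?]]|].
  split; last by split=> //; exact: ints_incr.
  by apply: next F3 => i1 a1 b1 e1; rewrite /lex_before; lia.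
apply: wp_for => // [|b s3 lt_bB [F8 [i8 a8 b8]]].
- by move=> b s3 [F [? ? ?]]; split=> //; apply: boundE; [case: F | exact: eBE].
apply: (@wp_weaken _ _ _ (InvE i a b B.+1) _ _ (leqnn _)) => // [s4 [F4 [? ? ? ?]]|].
  split; last by split=> //; exact: ints_incr.
  by apply: next F4 => i1 a1 b1 e1; rewrite /lex_before; lia.
apply: wp_for => // [|e s4 lt_eB [F9 vars]].
- by move=> e s4 [F [? ? ? ?]]; split=> //; apply: boundE; [case: F | exact: eBE].
apply: wp_weaken (leqnn _) _ (wp_fill_step F9 _ _ _ _ vars) => // s5 [F5 [? ? ? ?]].
by split=> //; split=> //; exact: ints_incr.
Qed.


(** * Choosing the final state and tracing back *)

Definition final_value (s : state) j : rat :=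
  nums s 6 (encode n.+1 n (ta j) j (te j)).

Definition best_target (s : state) m : Prop :=
  [/\ (ints s 10 0 <= B)%N, (ta (ints s 10 0) + ints s 10 0 + te (ints s 10 0) <= n)%N
    & forall j, (j < m)%N -> (j <= B)%N -> (ta j + j + te j <= n)%N ->
        final_value s (ints s 10 0) <= final_value s j].

Definition has_counts (f : nat -> bool * bool) j : Prop :=
  [/\ count_choices choice_both f n = ta j, count_choices choice_x f n = j
    & count_choices choice_y f n = te j].

Lemma wp_select_loop s : filled n 0 0 0 s -> ints s 10 0 = 0%N ->
  wp (For 6 (IAdd eB (IConst 1)) select_target)
    (B.+1 * (straight_time select_target + for_overhead (IAdd eB (IConst 1))))
    (fun s' => [/\ filled n 0 0 0 s', best_target s' B.+1 & ints s' 6 0 = B.+1]) s.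
Proof.
move=> done best0.
pose Inv j s1 := [/\ filled n 0 0 0 s1, best_target s1 j & ints s1 6 0 = j].
apply: (@wp_weaken _ _ _ (Inv B.+1) _ _ (leqnn _)) => //.
apply: wp_for => // [||j s1 lt_jB [F [le_best sum_best min_best] j6]].
- by split=> //; split; rewrite /= /update /= best0 ?addn0.
- move=> j s1 [F _ j6]; split=> //; have [[ok0 _ _ _] _ _] := F.
  by rewrite /= eBE // addn1.
have [[ok0 _ _ _] _ _] := F.
have nE : ieval s1 var_n = n by rewrite /= ok0.
have targetE q : ieval s1 (target_expr q) =
    encode n.+1 n (ta (ieval s1 q)) (ieval s1 q) (te (ieval s1 q)).
  rewrite -[LHS]/(((ieval s1 var_n * (ieval s1 var_n + 1) + ieval s1 (ea q)) *
    (ieval s1 var_n + 1) + ieval s1 q) * (ieval s1 var_n + 1) + ieval s1 (ee q))%N.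
  by rewrite nE eaE // eeE // addn1.
have testE : beval s1 (BAnd (BLeI (IAdd (IAdd (ea (var 6)) (var 6)) (ee (var 6))) var_n)
        (BNot (BLeQ (QGet 6 (target_expr (var 10))) (QGet 6 (target_expr (var 6)))))) =
    (ta j + j + te j <= n)%N && ~~ (final_value s1 (ints s1 10 0) <= final_value s1 j).
  rewrite -[LHS]/((ieval s1 (ea (var 6)) + ints s1 6 0 + ieval s1 (ee (var 6)) <=
    ieval s1 var_n)%N && ~~ (nums s1 6 (ieval s1 (target_expr (var 10))) <=
      nums s1 6 (ieval s1 (target_expr (var 6))))).
  by rewrite nE !targetE eaE // eeE //= j6.
apply: wp_if; rewrite testE.
- move=> /andP[sum_j worse]; apply: wp_iset; split=> //; last exact: ints_incr.
  split; rewrite /= /update /= j6 //.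
  move=> j' le_j'j le_j'B sum_j'.
  have [->//|lt_j'j] : j' = j \/ (j' < j)%N by lia.
  apply: le_trans (min_best _ lt_j'j le_j'B sum_j'); apply: ltW.
  by rewrite ltNge.
- move=> worse; apply: wp_skip; split=> //; last exact: ints_incr.
  split=> // j' le_j'j le_j'B sum_j'.
  have [eq_j|lt_j'j] : j' = j \/ (j' < j)%N by lia.
    by move: worse; rewrite -eq_j sum_j' negbK.
  exact: min_best.
Qed.

(** Supplies the attainment that complements [bellman_lower_bound]. The traced items form a suffix,
    whose cost depends on the counts of the items before it; hence an invariant that quantifies over
    prefixes. *)
Lemma wp_trace_loop s : filled n 0 0 0 s ->
  [/\ ints s 7 0 = ta (ints s 10 0), ints s 8 0 = ints s 10 0 & ints s 9 0 = te (ints s 10 0)] ->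
  (ints s 10 0 <= B)%N ->
  (ta (ints s 10 0) + ints s 10 0 + te (ints s 10 0) <= n)%N ->
  nums s 5 0 = final_value s (ints s 10 0) ->
  wp (For 6 var_n trace_item) (n * (200 + for_overhead var_n))
   (fun s' => [/\ nums s' 5 0 = nums s 5 0 & exists (f : nat -> bool * bool) j,
     [/\ (j <= B)%N, forall i, (i < n)%N -> ints s' 1 i = (f i).1 /\ ints s' 2 i = (f i).2,
         has_counts f j & nums s 5 0 = selection_cost C c d g f n]]) s.
Proof.
set J := ints s 10 0; move=> done [s7 s8 s9] le_JB sumJ value.
have [ok _ cells] := done; have [ok0 _ _ ok6] := ok.
pose V i a b e := nums s 6 (encode n.+1 i a b e).
pose same s1 := [/\ ints s1 0 = ints s 0, ints s1 3 = ints s 3, ints s1 4 = ints s 4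
  & nums s1 = nums s].
pose partial m a b e s1 := [/\ (a <= A)%N, (b <= B)%N, (e <= B)%N, (a + b + e <= m)%N &
  [/\ ints s1 7 0 = a, ints s1 8 0 = b & ints s1 9 0 = e]].
pose bits m s1 := forall i, (m <= i < n)%N -> (ints s1 1 i <= 1)%N /\ (ints s1 2 i <= 1)%N.
(* Completing the traced bits on the items before m by any selection that
   attains the value of the current cell attains the value of the target. *)
pose extends m a b e s1 := forall f : nat -> bool * bool,
  (forall i, (m <= i < n)%N -> ints s1 1 i = (f i).1 /\ ints s1 2 i = (f i).2) ->
  count_choices choice_both f m = a -> count_choices choice_x f m = b ->
  count_choices choice_y f m = e -> selection_cost C c d g f m = V m a b e ->
  has_counts f J /\ nums s 5 0 = selection_cost C c d g f n.
pose Inv t s1 := [/\ same s1, ints s1 6 0 = t, bits (n - t)%N s1 &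
  exists a b e, partial (n - t)%N a b e s1 /\ extends (n - t)%N a b e s1].
apply: (@wp_weaken _ _ _ (Inv n) _ _ (leqnn _)) => [s1|].
  rewrite /Inv subnn => -[[_ _ _ eq_nums] _ bit [a [b [e [[_ _ _ sum0 _] ext]]]]].
  split; first by rewrite eq_nums.
  (* Memory holds naturals; [bits] makes reading them back as Booleans exact. *)
  pose f i := (ints s1 1 i == 1%N, ints s1 2 i == 1%N).
  have fE i : (i < n)%N -> ints s1 1 i = (f i).1 /\ ints s1 2 i = (f i).2.
    by move=> lt_in; have [] := bit i lt_in; rewrite /f; do 2!case: (ints _ _ i) => [|[|]].
  have [a0 b0 e0] : [/\ a = 0, b = 0 & e = 0]%N by split; lia.
  subst a b e; exists f, J.
  have [|||||fJ cost_f] := ext f; rewrite /count_choices /selection_cost ?big_ord0 //.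
apply: wp_for => // [||t s1 lt_tn].
- split=> //; rewrite ?subn0; first by move=> i; lia.
  have /andP[leA leB] := target_bounds le_JB.
  exists (ta J), J, (te J); split=> // f _ fa fb fe ->; split=> //.
- by move=> t s1 [[eq0 _ _ _] -> _ _]; rewrite /= eq0 ok0.
have [i iE] : exists i, (n - t)%N = i.+1 by exists (n - t).-1; lia.
have iE' : (n - t.+1)%N = i by lia.
rewrite /Inv iE iE' => -[[eq0 eq3 eq4 eqn] t6 bit [a [b [e [[leA leB leB' sum [s17 s18 s19]] ext]]]]].
have [|//|//|//||//|o [o3 o4 [o_ok oE _]]] := cells i a b e; first by lia.
  by rewrite /lex_before; lia.
have itemE s2 : ints s2 0 = ints s 0 -> ints s2 6 0 = t ->
    ieval s2 (ISub (ISub var_n (var 6)) (IConst 1)) = i.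
  by move=> h0 h6; rewrite /= h0 h6 ok0 n_param iE subn1.
have cellE s2 : ints s2 0 = ints s 0 -> ints s2 6 0 = t -> ints s2 7 0 = a ->
    ints s2 8 0 = b -> ints s2 9 0 = e ->
    ieval s2 (encode_expr (ISub var_n (var 6)) (var 7) (var 8) (var 9)) = encode n.+1 i.+1 a b e.
  by move=> h0 h6 h7 h8 h9; rewrite /= h0 h6 h7 h8 h9 ok0 n_param iE addn1.
pose item := ISub (ISub var_n (var 6)) (IConst 1).
apply: wp_le; last first.
  apply: wp_seq; apply: wp_iset; rewrite itemE //.
  have -> : ieval s1 (IGet 3 (encode_expr (ISub var_n (var 6)) (var 7) (var 8) (var 9))) = o.1.
    by rewrite -o3 -eq3 -[encode _ _ _ _ _](cellE s1).
  set s2 := set_int s1 1 i o.1.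
  apply: wp_seq; apply: wp_iset; rewrite itemE //.
  have -> : ieval s2 (IGet 4 (encode_expr (ISub var_n (var 6)) (var 7) (var 8) (var 9))) = o.2.
    by rewrite -o4 -eq4 -[encode _ _ _ _ _](cellE s2).
  set s3 := set_int s2 2 i o.2.
  have x_s2 : ints s2 1 i = o.1 by exact: ints_set_int.
  have y_s3 : ints s3 2 i = o.2 by exact: ints_set_int.
  have xE s4 : ints s4 0 = ints s 0 -> ints s4 6 = ints s1 6 -> ints s4 1 = ints s2 1 ->
      ieval s4 (IGet 1 item) = o.1.
    move=> h0 h6 h1; rewrite -[LHS]/(ints s4 1 (ieval s4 item)).
    by rewrite itemE ?h6 // h1.
  have yE s4 : ints s4 0 = ints s 0 -> ints s4 6 = ints s1 6 -> ints s4 2 = ints s3 2 ->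
      ieval s4 (IGet 2 item) = o.2.
    move=> h0 h6 h1; rewrite -[LHS]/(ints s4 2 (ieval s4 item)).
    by rewrite itemE ?h6 // h1.
  apply: wp_seq; apply: wp_iset.
  have -> : ieval s3 (ISub (var 7) (IMul (IGet 1 item) (IGet 2 item))) = (a - choice_both o)%N.
    rewrite -[LHS]/(ints s1 7 0 - ieval s3 (IGet 1 item) * ieval s3 (IGet 2 item))%N.
    by rewrite xE // yE // s17 /choice_both; case: (o) => [[] []].
  set s4 := set_int s3 7 _ _.
  apply: wp_seq; apply: wp_iset.
  have -> : ieval s4 (ISub (var 8) (IMul (IGet 1 item) (ISub (IConst 1) (IGet 2 item)))) =
      (b - choice_x o)%N.
    rewrite -[LHS]/(ints s1 8 0 - ieval s4 (IGet 1 item) * (1 - ieval s4 (IGet 2 item)))%N.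
    by rewrite xE // yE // s18 /choice_x; case: (o) => [[] []].
  set s5 := set_int s4 8 _ _.
  apply: wp_iset.
  have -> : ieval s5 (ISub (var 9) (IMul (ISub (IConst 1) (IGet 1 item)) (IGet 2 item))) =
      (e - choice_y o)%N.
    rewrite -[LHS]/(ints s1 9 0 - (1 - ieval s5 (IGet 1 item)) * ieval s5 (IGet 2 item))%N.
    by rewrite xE // yE // s19 /choice_y; case: (o) => [[] []].
  set s6 := set_int s5 9 _ _.
  pose s' := set_int s6 6 0 (ints s6 6 0 + 1)%N.
  have x_old k : (i < k)%N -> ints s' 1 k = ints s1 1 k /\ ints s' 2 k = ints s1 2 k.
    by move=> lt_ik; rewrite /= /update /= (gtn_eqF lt_ik).
  have [x_new y_new] : ints s' 1 i = o.1 /\ ints s' 2 i = o.2 by split.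
  have allow := o_ok; rewrite /allowed in allow.
  split=> //.
  - by rewrite ints_set_int -[ints s6 6 0]/(ints s1 6 0) t6 addn1.
  - move=> k /andP[le_ik lt_kn]; rewrite -/s'.
    have [->|lt_ik] : k = i \/ (i < k)%N by lia.
      by rewrite x_new y_new; case: (o) => [[] []].
    by have [-> ->] := x_old k lt_ik; apply: bit; lia.
  exists (a - choice_both o)%N, (b - choice_x o)%N, (e - choice_y o)%N; split.
    by split; try lia; split; exact: ints_set_int.
  rewrite -/s' => f f_bits fa fb fe cost_f.
  (* The bits just written force every completion to agree with the stored decision at item [i], so
     the Bellman equation lengthens the prefix by this item. *)
  have fi : f i = o.
    have [|f1 f2] := f_bits i; first by lia.
    move: f1 f2; rewrite x_new y_new; case: (f i) => f1 f2; case: (o) => o1 o2 /=.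
    by case: f1; case: f2; case: o1; case: o2.
  have [fa1 fb1 fe1] : [/\ count_choices choice_both f i.+1 = a,
      count_choices choice_x f i.+1 = b & count_choices choice_y f i.+1 = e].
    by rewrite !count_choicesS fa fb fe fi; split; lia.
  apply: ext => //.
    move=> k /andP[lt_ik lt_kn]; have [<- <-] := x_old k lt_ik.
    by apply: f_bits; lia.
  by rewrite selection_costS cost_f fa1 fe1 fi [RHS]oE.
by [].
Qed.


Definition finish_program : com :=
  Seq (QSet 5 (IConst 0) (QGet 6 (target_expr (var 10))))
  (Seq (ISet 7 (IConst 0) (ea (var 10)))
  (Seq (ISet 8 (IConst 0) (var 10))
  (Seq (ISet 9 (IConst 0) (ee (var 10)))
       (For 6 var_n trace_item)))).

Definition finish_time : nat :=
  straight_time (QSet 5 (IConst 0) (QGet 6 (target_expr (var 10)))) +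
  (straight_time (ISet 7 (IConst 0) (ea (var 10))) +
  (4 + (straight_time (ISet 9 (IConst 0) (ee (var 10))) +
  n * (200 + for_overhead var_n)))).

Definition solved (s : state) : Prop :=
  (exists (f : nat -> bool * bool) j,
    [/\ (j <= B)%N, forall i, (i < n)%N -> ints s 1 i = (f i).1 /\ ints s 2 i = (f i).2,
         has_counts f j & nums s 5 0 = selection_cost C c d g f n]) /\
  (forall (f : nat -> bool * bool) j, (j <= B)%N -> has_counts f j ->
     nums s 5 0 <= selection_cost C c d g f n).

Lemma wp_finish s : filled n 0 0 0 s -> best_target s B.+1 ->
  wp finish_program finish_time solved s.
Proof.
move=> done [le_best sum_best min_best].
have [[ok0 _ _ ok6] _ cells] := done.
have targetE : ieval s (target_expr (var 10)) =
    encode n.+1 n (ta (ints s 10 0)) (ints s 10 0) (te (ints s 10 0)).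
  rewrite -[LHS]/(((ieval s var_n * (ieval s var_n + 1) + ieval s (ea (var 10))) *
    (ieval s var_n + 1) + ints s 10 0) * (ieval s var_n + 1) + ieval s (ee (var 10)))%N.
  by rewrite eaE // eeE // /= ok0 n_param addn1.
apply: wp_seq; apply: wp_qset; set s1 := set_num _ _ _ _.
have s1_5 : nums s1 5 0 = final_value s (ints s 10 0) by rewrite /final_value -targetE.
apply: wp_seq; apply: wp_iset; rewrite eaE //; set s2 := set_int _ _ _ _.
apply: wp_seq; apply: wp_iset; set s3 := set_int _ _ _ _.
apply: wp_seq; apply: wp_iset; rewrite eeE //; set s4 := set_int _ _ _ _.
apply: wp_weaken (leqnn _) _ (wp_trace_loop _ _ _ _ _) => //.
move=> s' [value sol]; split.
  by have [f [j [? ? ? ?]]] := sol; exists f, j; rewrite value; split.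
(* A final state reached by some selection passes the size test, so the chosen target has been
   compared with it. *)
move=> f j le_jB [fa fb fe]; have := count_choices_le f n; rewrite fa fb fe => sum_j.
rewrite value -[nums s4 5 0]/(nums s1 5 0) s1_5.
apply: le_trans (min_best j _ le_jB sum_j) _; first by rewrite ltnS.
have /andP[leA leB] := target_bounds le_jB.
pose V i a b e := nums s 6 (encode n.+1 i a b e).
have -> : final_value s j = V n (count_choices choice_both f n)
    (count_choices choice_x f n) (count_choices choice_y f n) by rewrite fa fb fe.
apply: (@bellman_lower_bound C c d g V n A B) => //; rewrite ?fa ?fb ?fe //.
move=> i a b e lt_in leaA lebB leeB sum.
have [|//|//|//||//|o [_ _ ?]] := cells i a b e; [lia | by rewrite /lex_before; lia | ].
by exists o.
Qed.

(** * Total running time *)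

Definition dp_time : nat :=
  2 * n * (10 + for_overhead (IMul (IConst 2) var_n)) + (fill_time + (3 +
  (B.+1 * (straight_time select_target + for_overhead (IAdd eB (IConst 1))) + finish_time))).

Lemma wp_dp_program s : input_ok s -> nums s 7 0 = 0 ->
  wp dp_program dp_time solved s.
Proof.
move=> ok r0; apply: wp_seq_mid (wp_rank_loop ok r0) _ => s1 [ok1 ranks1].
apply: wp_seq_mid (wp_fill_loop ok1 ranks1) _ => s2 F2.
apply: wp_seq; apply: wp_iset.
apply: wp_seq_mid (wp_select_loop _ _) _ => // s3 [F3 best3 _].
exact: wp_finish.
Qed.

(** Every summand depends on the program text alone, which makes the constant uniform over all
    instances. *)
Definition dp_const : nat :=
  (2 * (10 + for_overhead (IMul (IConst 2) var_n)) +
  (5000 + for_overhead (IAdd eB (IConst 1)) + for_overhead (IAdd eB (IConst 1))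
   + for_overhead (IAdd eA (IConst 1)) + for_overhead var_n) + 3 +
  (straight_time select_target + for_overhead (IAdd eB (IConst 1))) +
  (straight_time (QSet 5 (IConst 0) (QGet 6 (target_expr (var 10)))) +
   straight_time (ISet 7 (IConst 0) (ea (var 10))) + 5 +
   straight_time (ISet 9 (IConst 0) (ee (var 10))) + (200 + for_overhead var_n)))%N.

(** Each loop count is at most a fixed multiple of [D], the number of innermost iterations of the
    filling loop, so the coefficients can be added up. *)
Lemma dp_time_le : (dp_time <= dp_const * (n * (A.+1 * B.+1 ^ 2)))%N.
Proof.
clear -n_gt0; rewrite /dp_time /dp_const /fill_time /finish_time.
move: (for_overhead _) (for_overhead _) (for_overhead _) (for_overhead _).
move: (straight_time _) (straight_time _) (straight_time _) (straight_time _).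
move=> t1 t2 t3 t4 h1 h2 h3 h4.
set D := (n * (A.+1 * B.+1 ^ 2))%N.
have mul_D k u : (u <= D)%N -> (k * u <= k * D)%N by rewrite leq_mul2l orbC => ->.
have D_full : (n * A.+1 * B.+1 * B.+1 <= D)%N by rewrite /D; lia.
have D_e : (n * A.+1 * B.+1 <= D)%N.
  by apply: leq_trans D_full; rewrite leq_pmulr.
have D_b : (n * A.+1 <= D)%N by apply: leq_trans D_e; rewrite leq_pmulr.
have D_a : (n <= D)%N by apply: leq_trans D_b; rewrite leq_pmulr.
have D_B : (B.+1 <= D)%N by apply: leq_trans D_e; rewrite leq_pmull // muln_gt0 n_gt0.
have D_1 : (1 <= D)%N by apply: leq_trans D_a.
have := mul_D (2 * (10 + h4))%N _ D_a; have := mul_D (200 + h1 + h1)%N _ D_a.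
have := mul_D (5000 + h3)%N _ D_full; have := mul_D h3 _ D_e; have := mul_D h2 _ D_b.
have := mul_D (t4 + h3)%N _ D_B; have := mul_D (7 + t1 + t2 + t3)%N _ D_1.
by clearbody D; clear; move: A.+1 B.+1 => A' B'; lia.
Qed.

End Program.

(** The problem enters through the last hypothesis: the feasible pairs are those whose counts hit
    one of the final states. *)
Lemma dp_solves (eA eB : iexpr) (ea ee : iexpr -> iexpr) n (I : instance n)
    (params : seq nat) A B (ta te : nat -> nat)
    (F : n.-tuple bool -> n.-tuple bool -> Prop) :
  valid_instance I ->
  (forall i : 'I_n, tnth (weight I) i = 1 / tnth (max_deviation I) i) ->
  (forall i j : 'I_n, (i <= j)%N ->
     tnth (max_deviation I) j <= tnth (max_deviation I) i) ->
  (0 < n)%N -> nth 0%N params 0 = n -> (A <= n)%N -> (B <= n)%N ->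
  (forall s, ints s 0 = nth 0%N params -> ieval s eA = A) ->
  (forall s, ints s 0 = nth 0%N params -> ieval s eB = B) ->
  (forall s q, ints s 0 = nth 0%N params -> ieval s (ea q) = ta (ieval s q)) ->
  (forall s q, ints s 0 = nth 0%N params -> ieval s (ee q) = te (ieval s q)) ->
  (forall j, (j <= B)%N -> (ta j <= A)%N && (te j <= B)%N) ->
  (ta 0 + te 0 <= n)%N ->
  (forall (x y : n.-tuple bool) (f : nat -> bool * bool),
     (forall i : 'I_n, f i = (tnth x i, tnth y i)) ->
     F x y <-> exists2 j, (j <= B)%N & has_counts n ta te f j) ->
  solves_within (dp_program eA eB ea ee) I params F
    (dp_const eA eB ea ee * (n * (A.+1 * B.+1 ^ 2))).
Proof.
move=> valid weightE dev_noninc n_gt0 n_param leA leB eAE eBE eaE eeE bounds target0 FE.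
have [_ _ _ budget_gt0] := valid.
pose g := Num.trunc (budget I).
have budget_floor m : (m%:R <= budget I) = (m <= g)%N.
  by rewrite /g Num.Theory.truncn_ge_nat // ltW.
pose C := nth 0 (fixed_cost I); pose c := nth 0 (nominal_cost I).
pose d := nth 0 (max_deviation I).
have [||s [t [ex le_t sol]]] := @wp_dp_program eA eB ea ee n g A B params C c d ta te
  n_gt0 n_param leA leB eAE eBE eaE eeE bounds target0 (input_state I params).
(* The zero-initialized memory provides the base cell of the value table and, in the next goal,
   entry 0 of number array 7. *)
- by split.
- by [].
exists s, t; split=> //; first by apply: leq_trans le_t _; exact: dp_time_le.
have [[f [j [le_jB bits f_j value]]] min_value] := sol.
have objE x y h hE := @objectiveE n I g valid weightE dev_noninc budget_floor x y h hE.
exists [tuple (f i).1 | i < n], [tuple (f i).2 | i < n], (nums s 5 0).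
have fE (i : 'I_n) : f i = (tnth [tuple (f i).1 | i < n] i, tnth [tuple (f i).2 | i < n] i).
  by rewrite !tnth_mktuple; case: (f i).
split; first by split=> // i; rewrite tnth_mktuple; have [] := bits i (ltn_ord i).
split.
- by apply/(FE _ _ _ fE); exists j.
- by rewrite value (objE _ _ _ fE).
move=> x y; pose h i := (nth false x i, nth false y i).
have hE (i : 'I_n) : h i = (tnth x i, tnth y i) by rewrite /h -!tnth_nth.
move=> /(FE _ _ _ hE)[j' le_j' h_j']; rewrite (objE _ _ _ hE).
exact: min_value h_j'.
Qed.

(** * Feasibility in terms of the final states *)

Section Counts.
Variables (n : nat) (x y : n.-tuple bool) (f : nat -> bool * bool).
Hypothesis fE : forall i : 'I_n, f i = (tnth x i, tnth y i).

Lemma sum_both : (\sum_(i < n) tnth x i * tnth y i)%N = count_choices choice_both f n.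
Proof. by apply: eq_bigr => i _; rewrite fE mulnb. Qed.

Lemma sum_x : (\sum_(i < n) tnth x i)%N =
  (count_choices choice_both f n + count_choices choice_x f n)%N.
Proof.
rewrite -big_split; apply: eq_bigr => i _; rewrite fE.
by case: (tnth x i); case: (tnth y i).
Qed.

Lemma sum_y : (\sum_(i < n) tnth y i)%N =
  (count_choices choice_both f n + count_choices choice_y f n)%N.
Proof.
rewrite -big_split; apply: eq_bigr => i _; rewrite fE.
by case: (tnth x i); case: (tnth y i).
Qed.

(** The index j is the size of X :\: Y; as X and Y are disjoint, Y takes the remaining p - j
    items. *)
Lemma feasible_p_counts p : feasible_p p x y <->
  exists2 j, (j <= p)%N & has_counts n (fun=> 0%N) (subn p) f j.
Proof.
rewrite /feasible_p big_split /= sum_both sum_x sum_y /has_counts; split.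
  by move=> [? ?]; exists (count_choices choice_x f n); [lia | split; lia].
by move=> [j ? [? ? ?]]; lia.
Qed.

(** Equal sizes of X and Y give X :\: Y and Y :\: X a common size j, and p - j >= p - k means j <= k
    because k <= p. *)
Lemma feasible_pk_counts p k : (k <= p)%N -> feasible_pk p k x y <->
  exists2 j, (j <= k)%N & has_counts n (subn p) id f j.
Proof.
move=> le_kp; rewrite /feasible_pk sum_both sum_x sum_y /has_counts; split.
  by move=> [? ? ?]; exists (count_choices choice_x f n); [lia | split; lia].
by move=> [j ? [? ? ?]]; split; lia.
Qed.

End Counts.

Lemma solves_within_weaken prog n (I : instance n) params F T T' :
  (T <= T')%N -> solves_within prog I params F T -> solves_within prog I params F T'.
Proof.
move=> leT [s [t [ex le_t sol]]]; exists s, t; split=> //.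
exact: leq_trans leT.
Qed.

Theorem mainTheorem10 :
  (exists (prog : com) (K : nat),
     forall (n : nat) (I : instance n) (p : nat),
       valid_instance I ->
       (forall i : 'I_n, tnth (weight I) i = 1 / tnth (max_deviation I) i) ->
       (forall i j : 'I_n, (i <= j)%N ->
          tnth (max_deviation I) j <= tnth (max_deviation I) i) ->
       (0 < p <= n)%N ->
       solves_within prog I [:: n; p] (feasible_p p) (K * (n * p ^ 2))%N)
  /\
  (exists (prog : com) (K : nat),
     forall (n : nat) (I : instance n) (p k : nat),
       valid_instance I ->
       (forall i : 'I_n, tnth (weight I) i = 1 / tnth (max_deviation I) i) ->
       (forall i j : 'I_n, (i <= j)%N ->
          tnth (max_deviation I) j <= tnth (max_deviation I) i) ->
       (0 < k)%N -> (k <= p <= n)%N ->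
       solves_within prog I [:: n; p; k] (feasible_pk p k)
         (K * (n * k ^ 2 * p))%N).
Proof.
pose pE := IGet 0 (IConst 1); pose kE := IGet 0 (IConst 2).
have param s params m : ints s 0 = nth 0%N params ->
    ieval s (IGet 0 (IConst m)) = nth 0%N params m by rewrite /= => ->.
split.
- pose ea (q : iexpr) := IConst 0; pose ee q := ISub pE q.
  (* The factor 4 comes from (p + 1)^2 <= 4 p^2 for p >= 1; the intersection is empty, so its
     dimension contributes a factor 1. *)
  exists (dp_program (IConst 0) pE ea ee), (4 * dp_const (IConst 0) pE ea ee)%N.
  move=> n I p valid weightE dev_noninc /andP[p_gt0 le_pn].
  apply: (@solves_within_weaken _ _ _ _ _ (_ * (n * (1 * p.+1 ^ 2)))); last first.
    apply: (@dp_solves _ _ _ _ _ _ _ 0 p (fun=> 0%N) (subn p)) => //; try lia.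
    + by move=> s /param ->.
    + by move=> s q /param hp; rewrite /ee /pE -[LHS]/(ieval s (IGet 0 (IConst 1)) - ieval s q)%N hp.
    + by move=> x y f fE; exact: feasible_p_counts.
  have le_p : (p.+1 ^ 2 <= 4 * p ^ 2)%N by nia.
  rewrite mul1n -[leqRHS]mulnA [leqRHS]mulnCA leq_mul2l.
  by rewrite [leqRHS]mulnCA leq_mul2l le_p !orbT.
- pose ea q := ISub pE q.
  (* The factor 8 combines p + 1 <= 2 p with (k + 1)^2 <= 4 k^2. *)
  exists (dp_program pE kE ea id), (8 * dp_const pE kE ea id)%N.
  move=> n I p k valid weightE dev_noninc k_gt0 /andP[le_kp le_pn].
  apply: (@solves_within_weaken _ _ _ _ _ (_ * (n * (p.+1 * k.+1 ^ 2)))); last first.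
    apply: (@dp_solves _ _ _ _ _ _ _ p k (subn p) id) => //; try lia.
    + by move=> s /param ->.
    + by move=> s /param ->.
    + by move=> s q /param hp; rewrite /ea /pE -[LHS]/(ieval s (IGet 0 (IConst 1)) - ieval s q)%N hp.
    + by move=> x y f fE; exact: feasible_pk_counts.
  have le_p : (p.+1 <= 2 * p)%N by lia.
  have le_k : (k.+1 ^ 2 <= 4 * k ^ 2)%N by nia.
  rewrite -[leqRHS]mulnA [leqRHS]mulnCA leq_mul2l.
  have -> : (8 * (n * k ^ 2 * p))%N = (n * (2 * p * (4 * k ^ 2)))%N by lia.
  by rewrite leq_mul2l leq_mul // !orbT.
Qed.
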